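(* Let $g:\mathbb{R}^n\to\mathbb{R}^m$ be a map that is Lipschitz with respect to the $\ell_\infty$-norms, with $\ell_\infty$-norm Lipschitz constant $\mathrm{Lip}_\infty(g)$, and let $\mathsf{G}^{\min}=\begin{bmatrix}\underline{\mathsf{G}}^{\min}\\ \overline{\mathsf{G}}^{\min}\end{bmatrix}$ be its minimal inclusion function, defined for $x\le\widehat{x}$ and $i\in\{1,\dots,m\}$ by $$\underline{\mathsf{G}}^{\min}_i(x,\widehat{x})=\inf_{z\in[x,\widehat{x}]}g_i(z),\qquad \overline{\mathsf{G}}^{\min}_i(x,\widehat{x})=\sup_{z\in[x,\widehat{x}]}g_i(z).$$ Then, for every $x,\widehat{x}\in\mathbb{R}^n$ with $x\le\widehat{x}$, $$\|\underline{\mathsf{G}}^{\min}(x,\widehat{x})-\overline{\mathsf{G}}^{\min}(x,\widehat{x})\|_\infty\le \mathrm{Lip}_\infty(g)\,\|x-\widehat{x}\|_\infty .$$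
   Context: Inequalities between vectors are componentwise, and for $x\le\widehat{x}$ in $\mathbb{R}^n$ the interval $[x,\widehat{x}]$ is $\{z\in\mathbb{R}^n: x\le z\le\widehat{x}\}$. The $\ell_\infty$-norm Lipschitz constant $\mathrm{Lip}_\infty(g)$ is the smallest $L\ge 0$ such that $\|g(x)-g(y)\|_\infty\le L\|x-y\|_\infty$ for all $x,y\in\mathbb{R}^n$. *)

(* Defs.v *)
From mathcomp Require Import all_boot all_order all_algebra.
From mathcomp Require Import boolp classical_sets reals topology normedtype.
Set Implicit Arguments.
Unset Strict Implicit.
Unset Printing Implicit Defensive.
Import Order.TTheory GRing.Theory Num.Theory.
Import numFieldNormedType.Exports.
Local Open Scope classical_set_scope.
Local Open Scope ring_scope.

(* R^n is 'cV[R]_n; the library norm `|x| on it is mx_norm, the maximum of the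
   absolute values of the entries, i.e. the l_oo-norm. *)

Definition vec_le (R : realType) (n : nat) (x y : 'cV[R]_n) : Prop :=
  forall i : 'I_n, x i 0 <= y i 0.

Definition vec_itv (R : realType) (n : nat) (x y : 'cV[R]_n) : set 'cV[R]_n :=
  [set z | vec_le x z /\ vec_le z y].

Definition lip_bounds (R : realType) (n m : nat) (g : 'cV[R]_n -> 'cV[R]_m) :
    set R :=
  [set L | 0 <= L /\ L.-lipschitz g].

(* The least element of lip_bounds g; the default value 0 is returned only if
   there is none, i.e. if g is not Lipschitz. *)
Definition Lip_infty (R : realType) (n m : nat) (g : 'cV[R]_n -> 'cV[R]_m) : R :=
  xget 0 (lip_bounds g `&` lbound (lip_bounds g)).

(* The first m entries are the lower bounds, the last m the upper bounds. The
   value is meaningful for vec_le x y and g bounded on vec_itv x y: elsewhere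
   inf and sup return default values. *)
Definition min_incl (R : realType) (n m : nat) (g : 'cV[R]_n -> 'cV[R]_m)
    (x y : 'cV[R]_n) : 'cV[R]_(m + m) :=
  col_mx (\col_(i < m) inf [set g z i 0 | z in vec_itv x y])
         (\col_(i < m) sup [set g z i 0 | z in vec_itv x y]).

(* Main.v *)
(* Any two values of a coordinate g_i on [x, xhat] differ by at most
   Lip(g) |x - xhat|, since two points of the box are at distance at most
   |x - xhat|; hence so do the supremum and the infimum of g_i. *)
Require Import Defs.
From mathcomp Require Import all_boot all_order all_algebra.
From mathcomp Require Import boolp classical_sets reals topology normedtype.
Import Order.TTheory GRing.Theory Num.Theory.
Import numFieldNormedType.Exports.
Local Open Scope classical_set_scope.
Local Open Scope ring_scope.

Lemma mx_norm_entry_le (R : realType) (m n : nat) (A : 'M[R]_(m, n))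
    (i : 'I_m) (j : 'I_n) : `|A i j| <= `|A|.
Proof.
by rewrite [leRHS]/Num.norm /= mx_normrE; apply/bigmax_geP; right; exists (i, j).
Qed.

Lemma mx_norm_le (R : realType) (m n : nat) (A : 'M[R]_(m, n)) (c : R) :
  0 <= c -> (forall i j, `|A i j| <= c) -> `|A| <= c.
Proof.
by move=> c0 Ac; rewrite [leLHS]/Num.norm /= mx_normrE; apply: bigmax_le => // ? _.
Qed.

(** The least Lipschitz constant exists: for fixed [y != z] the quotient of [g y - g z] by [y - z]
    in norm bounds every Lipschitz constant from below, hence also bounds their infimum, which is
    therefore itself a Lipschitz constant. *)
Lemma Lip_infty_bounds (R : realType) (n m : nat) (g : 'cV[R]_n -> 'cV[R]_m) :
  lipschitz g -> lip_bounds g (Lip_infty g).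
Proof.
move=> [M [_ lipM]].
have ne : lip_bounds g !=set0.
  (* [lipschitz g] only provides the constants strictly above [M], and [M] may be negative. *)
  exists (Num.max 0 (M + 1)); split; first by rewrite le_max lexx.
  by apply: lipM; rewrite lt_max ltrDl ltr01 orbT.
have lb0 : lbound (lip_bounds g) 0 by move=> L [].
suff : (lip_bounds g `&` lbound (lip_bounds g)) (Lip_infty g) by case.
apply: xgetPex; exists (inf (lip_bounds g)).
split; last by apply: ge_inf; exists 0.
split=> [|[y z] _ /=]; first exact: lb_le_inf.
have [->|yz] := eqVneq y z; first by rewrite !subrr !normr0 mulr0.
rewrite -ler_pdivrMr ?normr_gt0 ?subr_eq0//; apply: lb_le_inf => // L [_ lipL].
rewrite ler_pdivrMr ?normr_gt0 ?subr_eq0//; exact: (lipL (y, z)).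
Qed.

Lemma vec_itv_norm_le (R : realType) (n : nat) (x y z w : 'cV[R]_n) :
  vec_itv x y z -> vec_itv x y w -> `|z - w| <= `|x - y|.
Proof.
move=> [xz zy] [xw wy]; apply: mx_norm_le => // i j; rewrite ord1.
apply: le_trans (mx_norm_entry_le _ _ _ _ i 0); rewrite !mxE.
move: (xz i) (zy i) (xw i) (wy i) => xzi zyi xwi wyi.
(* Both entries lie in the segment from [x i 0] to [y i 0], whose length bounds their difference. *)
rewrite [leRHS]distrC [leRHS]ger0_norm ?subr_ge0 ?(le_trans xzi)//.
by rewrite ler_norml opprB !lerB.
Qed.

Lemma dist_inf_sup_le (R : realType) (E : set R) (c : R) : E !=set0 ->
  (forall a b, E a -> E b -> a - b <= c) -> `|inf E - sup E| <= c.
Proof.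
move=> E0 Ec; have [e Ee] := E0.
(* Comparison with the fixed element [e] bounds [E] on both sides, so [inf] and [sup] are not
   default values. *)
have Eub : has_ubound E.
  by exists (c + e) => a Ea; rewrite -lerBlDr Ec.
have Elb : has_lbound E.
  by exists (e - c) => a Ea; rewrite lerBlDr -lerBlDl Ec.
have le_inf_sup : inf E <= sup E := le_trans (ge_inf Elb Ee) (ub_le_sup Eub Ee).
rewrite distrC ger0_norm ?subr_ge0// lerBlDr.
(* For each [a] in [E], [a - c] is a lower bound of [E]. *)
apply: ge_sup => // a Ea; rewrite -lerBlDl; apply: lb_le_inf => // b Eb.
by rewrite lerBlDl -lerBlDr Ec.
Qed.

Theorem theorem1 (R : realType) (n m : nat) (g : 'cV[R]_n -> 'cV[R]_m)
    (hg : lipschitz g) (x xhat : 'cV[R]_n) (hx : vec_le x xhat) :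
  `|usubmx (min_incl g x xhat) - dsubmx (min_incl g x xhat)|
    <= Lip_infty g * `|x - xhat|.
Proof.
have [L0 lipL] := Lip_infty_bounds _ _ _ _ hg.
apply: mx_norm_le => [|i j]; first exact: mulr_ge0.
rewrite col_mxKu col_mxKd !mxE; apply: dist_inf_sup_le.
  (* By [hx], the box contains its corner [x]. *)
  by exists (g x i 0), x => //; split=> // k.
move=> _ _ [z xz <-] [w xw <-].
have -> : g z i 0 - g w i 0 = (g z - g w) i 0 by rewrite !mxE.
apply: le_trans (ler_norm _) _.
apply: le_trans (mx_norm_entry_le _ _ _ _ _ _) _.
apply: le_trans (lipL (z, w) _) _ => //=.
by rewrite ler_wpM2l// vec_itv_norm_le.
Qed.
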